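(* Let $\Bbbk$ be a field of characteristic $0$, let $W$ be the Witt algebra over $\Bbbk$, and let $W_+$ be the positive Witt algebra over $\Bbbk$. The universal enveloping algebra $U(W_+)$ is neither right nor left noetherian. As a consequence, the universal enveloping algebra $U(W)$ is neither right nor left noetherian. Thus, for $L=W$ and for $L=W_+$, the following holds: $L$ is finite dimensional if and only if $U(L)$ is noetherian.
   Context: The Witt (or centerless Virasoro) algebra $W$ is the Lie algebra over $\Bbbk$ with basis $\{e_n\}_{n\in\mathbb{Z}}$ and Lie bracket $[e_n,e_m]=(m-n)e_{n+m}$. The positive Witt algebra $W_+$ is the Lie subalgebra of $W$ generated by $\{e_n\}_{n\ge 1}$ (it has basis $\{e_n\}_{n\geq 1}$). $U(L)$ denotes the universal enveloping algebra of a Lie algebra $L$. A ring is noetherian if it is both left and right noetherian. *)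

(* Defs.v *)
From HB Require Import structures.
From mathcomp Require Import all_boot all_order all_algebra.
From mathcomp Require Import generic_quotient ring_quotient.
From mathcomp Require Import boolp finmap monalg.
From mathcomp Require Import ring.

Set Implicit Arguments.
Unset Strict Implicit.
Unset Printing Implicit Defensive.

Import Order.TTheory GRing.Theory Num.Theory.
Local Open Scope ring_scope.
Local Open Scope quotient_scope.

Section Noetherian.
Variable R : pzRingType.
Implicit Types I : R -> Prop.

Definition left_ideal I :=
  [/\ I 0, forall x y, I x -> I y -> I (x + y) & forall a x, I x -> I (a * x)].

Definition right_ideal I :=
  [/\ I 0, forall x y, I x -> I y -> I (x + y) & forall a x, I x -> I (x * a)].

Definition two_sided_ideal I := left_ideal I /\ right_ideal I.

Definition ideal_gen (S : R -> Prop) (x : R) :=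
  forall I, two_sided_ideal I -> (forall y, S y -> I y) -> I x.

(* The ascending chain condition. *)
Definition acc (ideal : (R -> Prop) -> Prop) :=
  forall I : nat -> R -> Prop,
    (forall n, ideal (I n)) ->
    (forall n x, I n x -> I n.+1 x) ->
    exists N, forall n, (N <= n)%N -> forall x, I n x <-> I N x.

Definition left_noetherian := acc left_ideal.
Definition right_noetherian := acc right_ideal.
Definition noetherian := left_noetherian /\ right_noetherian.

Lemma ideal_gen_ideal S : two_sided_ideal (ideal_gen S).
Proof.
split; split.
- by move=> I [[]].
- by move=> x y Ix Iy I II SI; case: (II) => -[_ + _ _]; apply; [apply: Ix|apply: Iy].
- by move=> a x Ix I II SI; case: (II) => -[_ _ + _]; apply; apply: Ix.
- by move=> I [[]].
- by move=> x y Ix Iy I II SI; case: (II) => -[_ + _ _]; apply; [apply: Ix|apply: Iy].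
- by move=> a x Ix I II SI; case: (II) => _ [_ _]; apply; apply: Ix.
Qed.

End Noetherian.

Definition finite_dim (k : fieldType) (V : lmodType k) :=
  exists (n : nat) (b : 'I_n -> V),
    forall v, exists c : 'I_n -> k, v = \sum_(i < n) c i *: b i.

HB.mixin Record Lmodule_isLie (k : pzRingType) L of GRing.Lmodule k L := {
  lie : L -> L -> L;
  lieDZl : forall (a : k) (x y z : L), lie (a *: x + y) z = a *: lie x z + lie y z;
  lieDZr : forall (a : k) (x y z : L), lie x (a *: y + z) = a *: lie x y + lie x z;
  liexx : forall x, lie x x = 0;
  lie_jacobi : forall x y z, lie x (lie y z) + lie y (lie z x) + lie z (lie x y) = 0
}.

#[short(type="lieAlgType")]
HB.structure Definition LieAlgebra (k : pzRingType) :=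
  {L of GRing.Lmodule k L & Lmodule_isLie k L}.

Section LieSubalgebra.
Variables (k : fieldType) (L : lieAlgType k).
Implicit Types P S : L -> Prop.

Definition lie_subalgebra P :=
  [/\ P 0, forall (a : k) x y, P x -> P y -> P (a *: x + y)
    & forall x y, P x -> P y -> P (lie x y)].

Definition lie_gen S : {pred L} :=
  fun x => `[< forall P, lie_subalgebra P -> (forall y, S y -> P y) -> P x >].

Lemma lie_genP S x :
  reflect (forall P, lie_subalgebra P -> (forall y, S y -> P y) -> P x)
          (x \in lie_gen S).
Proof. exact: asboolP. Qed.

Lemma mem_lie_gen S x : S x -> x \in lie_gen S.
Proof. by move=> Sx; apply/lie_genP => P _; apply. Qed.

Lemma lie_gen_submod S : submod_closed (lie_gen S).
Proof.
split; first by apply/lie_genP => P [].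
move=> a x y /lie_genP Sx /lie_genP Sy; apply/lie_genP => P PL SP.
by case: (PL) => _ + _; apply; [apply: Sx|apply: Sy].
Qed.

Lemma lie_gen_lie S x y :
  x \in lie_gen S -> y \in lie_gen S -> lie x y \in lie_gen S.
Proof.
move=> /lie_genP Sx /lie_genP Sy; apply/lie_genP => P PL SP.
by case: (PL) => _ _; apply; [apply: Sx|apply: Sy].
Qed.

HB.instance Definition _ S :=
  GRing.isSubmodClosed.Build k L (lie_gen S) (lie_gen_submod S).

Record lie_gen_of S := LieGenOf {
  lie_gen_val :> L;
  lie_gen_valP : lie_gen_val \in lie_gen S
}.

HB.instance Definition _ S := [isSub for @lie_gen_val S].
HB.instance Definition _ S := [Choice of lie_gen_of S by <:].
HB.instance Definition _ S :=
  [SubChoice_isSubZmodule of lie_gen_of S by <:].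
HB.instance Definition _ S :=
  [SubZmodule_isSubLmodule of lie_gen_of S by <:].

Section Bracket.
Variable S : L -> Prop.
Implicit Types x y z : lie_gen_of S.

Definition lie_gen_lie_of x y : lie_gen_of S :=
  LieGenOf (lie_gen_lie (lie_gen_valP x) (lie_gen_valP y)).

Fact lie_gen_lieDZl (a : k) x y z : lie_gen_lie_of (a *: x + y) z
  = a *: lie_gen_lie_of x z + lie_gen_lie_of y z.
Proof. by apply: val_inj; rewrite /= lieDZl. Qed.

Fact lie_gen_lieDZr (a : k) x y z : lie_gen_lie_of x (a *: y + z)
  = a *: lie_gen_lie_of x y + lie_gen_lie_of x z.
Proof. by apply: val_inj; rewrite /= lieDZr. Qed.

Fact lie_gen_liexx x : lie_gen_lie_of x x = 0.
Proof. by apply: val_inj; rewrite /= liexx. Qed.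

Fact lie_gen_jacobi x y z :
  lie_gen_lie_of x (lie_gen_lie_of y z) + lie_gen_lie_of y (lie_gen_lie_of z x)
    + lie_gen_lie_of z (lie_gen_lie_of x y) = 0.
Proof. by apply: val_inj; rewrite /= lie_jacobi. Qed.

HB.instance Definition _ := Lmodule_isLie.Build k (lie_gen_of S)
  lie_gen_lieDZl lie_gen_lieDZr lie_gen_liexx lie_gen_jacobi.

End Bracket.
End LieSubalgebra.

Definition witt (k : fieldType) : Type := {malg k[int]}.

Section Witt.
Variable k : fieldType.
Local Notation W := (witt k).

HB.instance Definition _ := GRing.Lmodule.on W.

Definition witt_e (n : int) : W := << n >>.

Definition witt_lie (x y : W) : W :=
  \sum_(n <- msupp x) \sum_(m <- msupp y)
    (x@_n * y@_m * (m - n)%:~R) *: witt_e (n + m).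

Implicit Types x y z : W.

Lemma witt_lieEw (A B : {fset int}) x y :
  (msupp x `<=` A)%fset -> (msupp y `<=` B)%fset ->
  witt_lie x y = \sum_(n <- A) \sum_(m <- B)
    (x@_n * y@_m * (m - n)%:~R) *: witt_e (n + m).
Proof.
move=> xA yB; rewrite /witt_lie (big_fset_incl _ xA) /=; last first.
  move=> n _ /mcoeff_outdom x0; rewrite big1 // => m _.
  by rewrite x0 !mul0r scale0r.
apply: eq_bigr => n _; rewrite (big_fset_incl _ yB) //= => m _ /mcoeff_outdom y0.
by rewrite y0 mulr0 mul0r scale0r.
Qed.

Fact witt_lieDZl (a : k) x y z :
  witt_lie (a *: x + y) z = a *: witt_lie x z + witt_lie y z.
Proof.
pose A := (msupp x `|` msupp y `|` msupp (a *: x + y))%fset.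
have xA : (msupp x `<=` A)%fset by rewrite /A -fsetUA fsubsetUl.
have yA : (msupp y `<=` A)%fset by rewrite /A fsetUC fsetUA fsubsetUr.
have xyA : (msupp (a *: x + y) `<=` A)%fset by rewrite fsubsetUr.
have zz : (msupp z `<=` msupp z)%fset by [].
rewrite (witt_lieEw xyA zz) (witt_lieEw xA zz) (witt_lieEw yA zz).
rewrite scaler_sumr -big_split /=; apply: eq_bigr => n _.
rewrite scaler_sumr -big_split /=; apply: eq_bigr => m _.
rewrite mcoeffD mcoeffZ !mulrDl scalerDl scalerA.
by rewrite !mulrA.
Qed.

Fact witt_lieC x y : witt_lie x y = - witt_lie y x.
Proof.
rewrite /witt_lie exchange_big /= -sumrN; apply: eq_bigr => m _.
rewrite -sumrN; apply: eq_bigr => n _.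
have -> : x@_n * y@_m * (m - n)%:~R = - (y@_m * x@_n * (n - m)%:~R).
  by rewrite -mulrN -intrN opprB [y@_ _ * _]mulrC.
by rewrite scaleNr (addrC n m).
Qed.

Fact witt_lieDZr (a : k) x y z :
  witt_lie x (a *: y + z) = a *: witt_lie x y + witt_lie x z.
Proof. by rewrite witt_lieC witt_lieDZl opprD -scalerN -!witt_lieC. Qed.

Lemma witt_ind (P : W -> Prop) :
  P 0 -> (forall (a : k) n x, P x -> P (a *: witt_e n + x)) -> forall x, P x.
Proof.
move=> P0 PD x; rewrite (monalgE x).
elim: (enum_fset _) => [|n s IH]; first by rewrite big_nil.
rewrite big_cons; suff -> : << x@_n *g n >> = x@_n *: witt_e n by apply: PD.
by apply/malgP => m; rewrite mcoeffZ !mcoeffU mulr_natr.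
Qed.

Lemma witt_lieE n m : witt_lie (witt_e n) (witt_e m) = (m - n)%:~R *: witt_e (n + m).
Proof.
by rewrite (witt_lieEw (msuppU_le) (msuppU_le)) !big_seq_fset1 !mcoeffUU !mul1r.
Qed.

Lemma witt_lie0l x : witt_lie 0 x = 0.
Proof. by rewrite /witt_lie msupp0 big_seq_fset0. Qed.

Lemma witt_lie0r x : witt_lie x 0 = 0.
Proof. by rewrite witt_lieC witt_lie0l oppr0. Qed.

Lemma witt_lieZr (a : k) x y : witt_lie x (a *: y) = a *: witt_lie x y.
Proof. by rewrite -[a *: y]addr0 witt_lieDZr witt_lie0r addr0. Qed.

Lemma witt_lieDr x y z : witt_lie x (y + z) = witt_lie x y + witt_lie x z.
Proof. by rewrite -[y]scale1r witt_lieDZr !scale1r. Qed.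

Fact witt_liexx x : witt_lie x x = 0.
Proof.
elim/witt_ind: x => [|a n x IH]; first exact: witt_lie0l.
rewrite witt_lieDZl !witt_lieDr !witt_lieZr witt_lieE subrr scale0r IH.
by rewrite scaler0 add0r addr0 [witt_lie x _]witt_lieC scalerN subrr.
Qed.

Fact witt_jacobi x y z :
  witt_lie x (witt_lie y z) + witt_lie y (witt_lie z x)
    + witt_lie z (witt_lie x y) = 0.
Proof.
have DZ a u v x' y' : witt_lie x' (witt_lie (a *: u + v) y')
    = a *: witt_lie x' (witt_lie u y') + witt_lie x' (witt_lie v y').
  by rewrite witt_lieDZl witt_lieDZr.
have DZ' a u v x' y' : witt_lie x' (witt_lie y' (a *: u + v))
    = a *: witt_lie x' (witt_lie y' u) + witt_lie x' (witt_lie y' v).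
  by rewrite !witt_lieDZr.
have comb (a : k) (p q r p' q' r' : W) : p + q + r = 0 -> p' + q' + r' = 0 ->
    (a *: p + p') + (a *: q + q') + (a *: r + r') = 0.
  move=> e e'.
  by rewrite (addrACA (a *: p)) (addrACA (a *: p + a *: q)) -!scalerDr e scaler0 add0r e'.
elim/witt_ind: x y z => [y z|a n x IHx y z].
  by rewrite !(witt_lie0l, witt_lie0r) !addr0.
rewrite DZ DZ' witt_lieDZl; apply: (comb); last exact: IHx.
elim/witt_ind: y z => [z|b m y IHy z].
  by rewrite !(witt_lie0l, witt_lie0r) !addr0.
rewrite DZ DZ' witt_lieDZl; apply: (comb); last exact: IHy.
elim/witt_ind: z => [|c p z IHz].
  by rewrite !(witt_lie0l, witt_lie0r) !addr0.
rewrite DZ DZ' witt_lieDZl; apply: (comb); last exact: IHz.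
rewrite !witt_lieE !witt_lieZr !witt_lieE !scalerA.
have -> : m + (p + n) = n + (m + p) by rewrite addrCA addrC addrCA addrA addrC.
have -> : p + (n + m) = n + (m + p) by rewrite addrCA [p + m]addrC.
rewrite -!scalerDl -!intrM -!intrD.
suff -> : (p - m) * (m + p - n) + (n - p) * (p + n - m) + (m - n) * (n + m - p) = 0
  by rewrite scale0r.
by ring.
Qed.

HB.instance Definition _ :=
  Lmodule_isLie.Build k W witt_lieDZl witt_lieDZr witt_liexx witt_jacobi.

Lemma lie_witt_e n m :
  lie (witt_e n) (witt_e m) = (m - n)%:~R *: witt_e (n + m).
Proof. exact: witt_lieE. Qed.

End Witt.

Definition witt_pos_gen (k : fieldType) (x : witt k) :=
  exists2 n : int, 1 <= n & x = witt_e k n.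

Definition witt_pos (k : fieldType) : Type := lie_gen_of (@witt_pos_gen k).
HB.instance Definition _ (k : fieldType) := LieAlgebra.on (witt_pos k).

(* W_+ has basis the e_n with n >= 1. *)
Lemma witt_posP (k : fieldType) (x : witt k) :
  reflect (forall n : int, ~~ (1 <= n) -> x@_n = 0) (x \in lie_gen (@witt_pos_gen k)).
Proof.
apply: (iffP idP) => [/lie_genP Wx|x0].
  apply: (Wx (fun x : witt k => forall n : int, ~~ (1 <= n) -> x@_n = 0)).
    split=> [n _|a y z y0 z0 n n1|y z y0 z0 n n1]; first by rewrite mcoeff0.
      by rewrite mcoeffD mcoeffZ y0 // z0 // mulr0 addr0.
    rewrite [lie y z]/(witt_lie y z) /witt_lie raddf_sum big1 // => i _.
    rewrite raddf_sum big1 // => j _ /=; rewrite mcoeffZ mcoeffU.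
    have [i1|/y0 ->] := boolP (1 <= i); last by rewrite !mul0r.
    have [j1|/z0 ->] := boolP (1 <= j); last by rewrite mulr0 !mul0r.
    have [e|_] := eqVneq (i + j) n; last by rewrite mulr0.
    by move: n1; rewrite -e (le_trans i1) // lerDl (le_trans _ j1).
  by move=> _ [m m1 ->] n n1; rewrite mcoeffU; case: eqP n1 => // <-; rewrite m1.
rewrite (monalgE x); apply: rpred_sum => n _.
have -> : << x@_n *g n >> = x@_n *: witt_e k n.
  by apply/malgP => m; rewrite mcoeffZ !mcoeffU mulr_natr.
have [n1|/x0 ->] := boolP (1 <= n); last by rewrite scale0r rpred0.
by apply: rpredZ; apply: mem_lie_gen; exists n.
Qed.

(* The free associative algebra k<X>. The alias is needed because the library
   declares {malg k[M]} as an algebra for commutative monoids M only. *)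
Definition free_alg (k : fieldType) (X : choiceType) : Type :=
  {malg k[{fmonom X}]}.

Section FreeAlgebra.
Variables (k : fieldType) (X : choiceType).
Local Notation F := (free_alg k X).

HB.instance Definition _ := GRing.Lalgebra.on F.

Definition free_gen (x : X) : F := << fmu x >>.

Fact free_scaleAr (c : k) (u v : F) : c *: (u * v) = u * (c *: v).
Proof.
apply/malgP => m; rewrite mcoeffZ mcoeffMl mulr_sumr.
rewrite (mcoeffMlw _ (fsubset_refl _) (msuppZ_le c v)).
apply: eq_bigr => i _; rewrite mulr_sumr; apply: eq_bigr => j _.
by rewrite mcoeffZ mulrnAr mulrCA.
Qed.

HB.instance Definition _ := GRing.Lalgebra_isAlgebra.Build k F free_scaleAr.

Lemma free_genE (s : seq X) : << FMonom s >> = \prod_(x <- s) free_gen x :> F.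
Proof.
elim: s => [|x s IH]; first by rewrite big_nil -fmoneE.
rewrite big_cons -IH /free_gen malgME !msuppU1 !big_seq_fset1 !mcoeffUU mulr1.
by congr << _ *g _ >>; rewrite fmuE; apply/esym/eqP; rewrite fmP fmM.
Qed.

Lemma free_ind (P : F -> Prop) : P 0 ->
  (forall (a : k) s u, P u -> P (a *: \prod_(x <- s) free_gen x + u)) ->
  forall u, P u.
Proof.
move=> P0 PD u; rewrite (monalgE u).
elim: (enum_fset _) => [|[m] s IH]; first by rewrite big_nil.
rewrite big_cons; set a := u@__.
suff -> : << a *g FMonom m >> = a *: \prod_(x <- m) free_gen x by apply: PD.
by rewrite -free_genE; apply/malgP => i; rewrite mcoeffZ !mcoeffU mulr_natr.
Qed.

Section Lift.
Variables (A : algType k) (f : X -> A).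

Definition free_lift_monom (m : {fmonom X}) : A := \prod_(x <- m) f x.

Fact free_lift_monom_morph : mmorphism free_lift_monom.
Proof.
rewrite /free_lift_monom.
by split=> [m n|]; rewrite ?fmM ?big_cat //= fm1 big_nil.
Qed.

HB.instance Definition _ := isMultiplicative.Build {fmonom X} A
  free_lift_monom free_lift_monom_morph.

Definition free_lift (u : F) : A := mmap (in_alg A) free_lift_monom u.

Fact free_lift_zmod : zmod_morphism free_lift.
Proof. exact: raddfB. Qed.

Fact free_lift_monoid : monoid_morphism free_lift.
Proof.
have [M o] : multiplicative free_lift.
  apply: commr_mmap_is_multiplicative => u m n /=.
  by rewrite /GRing.comm mulr_algl mulr_algr.
by split.
Qed.

Fact free_liftZ : scalable free_lift.
Proof. by move=> c u; rewrite /free_lift mmapZ /= mulr_algl. Qed.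

HB.instance Definition _ := GRing.isZmodMorphism.Build F A free_lift free_lift_zmod.
HB.instance Definition _ := GRing.isMonoidMorphism.Build F A free_lift free_lift_monoid.
HB.instance Definition _ := GRing.isScalable.Build k F A *:%R free_lift free_liftZ.

Lemma free_lift_gen x : free_lift (free_gen x) = f x.
Proof. by rewrite /free_lift mmapU /= /free_lift_monom fmU big_seq1 scale1r mul1r. Qed.

End Lift.
End FreeAlgebra.

(* U(L) is the free algebra on the set L modulo the two-sided ideal generated
   by the relations [a x + y] = a [x] + [y], which give the tensor algebra of
   L, and [x][y] - [y][x] = [lie x y]. *)
Section UEA.
Variables (k : fieldType) (L : lieAlgType k).
Local Notation F := (free_alg k L).
Local Notation gen := (@free_gen k L).

Variant uea_rel : F -> Prop :=
| UeaLinear (a : k) (x y : L) : uea_rel (gen (a *: x + y) - (a *: gen x + gen y))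
| UeaLie (x y : L) : uea_rel (gen x * gen y - gen y * gen x - gen (lie x y)).

Lemma free_lift_rel (A : algType k) (f : L -> A) :
  linear f -> (forall x y, f (lie x y) = f x * f y - f y * f x) ->
  forall r, uea_rel r -> free_lift f r = 0.
Proof.
move=> f_lin f_lie r [a x y|x y].
  by rewrite rmorphB rmorphD /= free_liftZ !free_lift_gen f_lin subrr.
by rewrite !rmorphB !rmorphM /= !free_lift_gen f_lie subrr.
Qed.

Definition uea_ideal : {pred F} := fun u => `[< ideal_gen uea_rel u >].

Lemma uea_idealP u : reflect (ideal_gen uea_rel u) (u \in uea_ideal).
Proof. exact: asboolP. Qed.

Lemma uea_idealMl u v : v \in uea_ideal -> u * v \in uea_ideal.
Proof.
move=> /uea_idealP Iv; apply/uea_idealP.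
by case: (ideal_gen_ideal uea_rel) => -[_ _ M] _; apply: M.
Qed.

Lemma uea_idealMr u v : u \in uea_ideal -> u * v \in uea_ideal.
Proof.
move=> /uea_idealP Iu; apply/uea_idealP.
by case: (ideal_gen_ideal uea_rel) => _ [_ _ M]; apply: M.
Qed.

Fact uea_ideal_zmod : zmod_closed uea_ideal.
Proof.
case: (ideal_gen_ideal uea_rel) => -[I0 ID IM] _; split; first exact/uea_idealP.
move=> u v /uea_idealP Iu /uea_idealP Iv; apply/uea_idealP.
by apply: ID => //; rewrite -mulN1r; apply: IM.
Qed.

HB.instance Definition _ := GRing.isZmodClosed.Build F uea_ideal uea_ideal_zmod.

Lemma uea_rel_ideal u : uea_rel u -> u \in uea_ideal.
Proof. by move=> ru; apply/uea_idealP => I _; apply. Qed.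

Lemma uea_ideal_ker (A : algType k) (g : {lrmorphism F -> A}) u :
  (forall r, uea_rel r -> g r = 0) -> u \in uea_ideal -> g u = 0.
Proof.
move=> g0 /uea_idealP/(_ (fun u => g u = 0)); apply => //.
split; split; rewrite ?rmorph0 //= => a x; rewrite ?rmorphD ?rmorphM /=.
- by move=> -> ->; rewrite addr0.
- by move=> ->; rewrite mulr0.
- by move=> -> ->; rewrite addr0.
- by move=> ->; rewrite mul0r.
Qed.

Definition uea : Type := Quotient.quot uea_ideal.

HB.instance Definition _ := GRing.Zmodule.on uea.
HB.instance Definition _ := EqQuotient.on uea.

Definition uea_pi (u : F) : uea := \pi_uea u.

Lemma uea_piP u v : reflect (uea_pi u = uea_pi v) (u - v \in uea_ideal).
Proof. by rewrite Quotient.idealrBE; apply: eqP. Qed.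

Lemma uea_piK (x : uea) : uea_pi (repr x) = x.
Proof. exact: reprK. Qed.

Lemma uea_repr u : repr (uea_pi u) - u \in uea_ideal.
Proof. by apply/uea_piP; rewrite uea_piK. Qed.

Lemma uea_piB : zmod_morphism uea_pi.
Proof. by move=> u v; rewrite /uea_pi !piE. Qed.

HB.instance Definition _ := GRing.isZmodMorphism.Build F uea uea_pi uea_piB.

Definition uea_one : uea := uea_pi 1.
Definition uea_mul (x y : uea) : uea := uea_pi (repr x * repr y).
Definition uea_scale (a : k) (x : uea) : uea := uea_pi (a *: repr x).

Lemma uea_piM u v : uea_pi (u * v) = uea_mul (uea_pi u) (uea_pi v).
Proof.
apply/esym/uea_piP; rewrite -(subrKA (repr (uea_pi u) * v)) -mulrBr -mulrBl.
by apply: rpredD; [apply: uea_idealMl|apply: uea_idealMr]; apply: uea_repr.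
Qed.

Lemma uea_piZ a u : uea_pi (a *: u) = uea_scale a (uea_pi u).
Proof.
by apply/esym/uea_piP; rewrite -scalerBr -mulr_algl uea_idealMl ?uea_repr.
Qed.

Lemma uea_surj (x : uea) : exists u, x = uea_pi u.
Proof. by exists (repr x); rewrite uea_piK. Qed.

Fact uea_mulA : associative uea_mul.
Proof.
move=> x y z; have [u ->] := uea_surj x; have [v ->] := uea_surj y.
by have [w ->] := uea_surj z; rewrite -!uea_piM mulrA.
Qed.

Fact uea_mul1x : left_id uea_one uea_mul.
Proof. by move=> x; have [u ->] := uea_surj x; rewrite -uea_piM mul1r. Qed.

Fact uea_mulx1 : right_id uea_one uea_mul.
Proof. by move=> x; have [u ->] := uea_surj x; rewrite -uea_piM mulr1. Qed.

Fact uea_mulDl : left_distributive uea_mul +%R.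
Proof.
move=> x y z; have [u ->] := uea_surj x; have [v ->] := uea_surj y.
by have [w ->] := uea_surj z; rewrite -raddfD -!uea_piM mulrDl raddfD.
Qed.

Fact uea_mulDr : right_distributive uea_mul +%R.
Proof.
move=> x y z; have [u ->] := uea_surj x; have [v ->] := uea_surj y.
by have [w ->] := uea_surj z; rewrite -raddfD -!uea_piM mulrDr raddfD.
Qed.

(* The augmentation separates 1 from 0. *)
Fact uea_one_neq0 : uea_one != 0.
Proof.
apply/eqP; rewrite -[0](raddf0 uea_pi) => /uea_piP; rewrite subr0.
pose g : {lrmorphism F -> k^o} := @free_lift k L k^o (fun=> 0).
have g0 r : uea_rel r -> g r = 0.
  apply: free_lift_rel => [a x y|x y]; first by rewrite scaler0 addr0.
  by rewrite mulr0 subr0.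
by move=> /(uea_ideal_ker g0); rewrite rmorph1 => /eqP; rewrite oner_eq0.
Qed.

HB.instance Definition _ := GRing.Zmodule_isNzRing.Build uea
  uea_mulA uea_mul1x uea_mulx1 uea_mulDl uea_mulDr uea_one_neq0.

Fact uea_scaleA (a b : k) (x : uea) :
  uea_scale a (uea_scale b x) = uea_scale (a * b) x.
Proof. by have [u ->] := uea_surj x; rewrite -!uea_piZ scalerA. Qed.

Fact uea_scale1 : left_id 1 uea_scale.
Proof. by move=> x; have [u ->] := uea_surj x; rewrite -uea_piZ scale1r. Qed.

Fact uea_scaleDr : right_distributive uea_scale +%R.
Proof.
move=> a x y; have [u ->] := uea_surj x; have [v ->] := uea_surj y.
by rewrite -raddfD -!uea_piZ scalerDr raddfD.
Qed.

Fact uea_scaleDl x : {morph uea_scale^~ x : a b / a + b}.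
Proof.
move=> a b; have [u ->] := uea_surj x.
by rewrite -!uea_piZ scalerDl raddfD.
Qed.

HB.instance Definition _ := GRing.Zmodule_isLmodule.Build k uea
  uea_scaleA uea_scale1 uea_scaleDr uea_scaleDl.

Fact uea_scaleAl (a : k) (x y : uea) : a *: (x * y) = (a *: x) * y.
Proof.
have [u ->] := uea_surj x; have [v ->] := uea_surj y.
by rewrite -[LHS]/(uea_scale a (uea_mul _ _)) -uea_piM -uea_piZ scalerAl
           uea_piM uea_piZ.
Qed.

HB.instance Definition _ := GRing.Lmodule_isLalgebra.Build k uea uea_scaleAl.

Fact uea_scaleAr (a : k) (x y : uea) : a *: (x * y) = x * (a *: y).
Proof.
have [u ->] := uea_surj x; have [v ->] := uea_surj y.
by rewrite -[LHS]/(uea_scale a (uea_mul _ _)) -uea_piM -uea_piZ scalerAr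
           uea_piM uea_piZ.
Qed.

HB.instance Definition _ := GRing.Lalgebra_isAlgebra.Build k uea uea_scaleAr.

Fact uea_pi_monoid : monoid_morphism uea_pi.
Proof. by split=> // u v; rewrite uea_piM. Qed.

Fact uea_pi_scalable : scalable uea_pi.
Proof. by move=> a u; rewrite uea_piZ. Qed.

HB.instance Definition _ :=
  GRing.isMonoidMorphism.Build F uea uea_pi uea_pi_monoid.
HB.instance Definition _ :=
  GRing.isScalable.Build k F uea *:%R uea_pi uea_pi_scalable.

Definition uea_in (x : L) : uea := uea_pi (gen x).

Fact uea_in_linear : linear uea_in.
Proof.
move=> a x y; rewrite -linearP; apply/uea_piP/uea_rel_ideal.
exact: UeaLinear.
Qed.

HB.instance Definition _ :=
  GRing.isLinear.Build k L uea *:%R uea_in uea_in_linear.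

Lemma uea_in_lie x y :
  uea_in (lie x y) = uea_in x * uea_in y - uea_in y * uea_in x.
Proof.
rewrite -!rmorphM -rmorphB; apply/esym/uea_piP/uea_rel_ideal; exact: UeaLie.
Qed.

Section Universal.
Variables (A : algType k) (f : {linear L -> A}).
Hypothesis f_lie : forall x y, f (lie x y) = f x * f y - f y * f x.

Definition uea_lift (x : uea) : A := free_lift f (repr x).

Lemma uea_lift_pi u : uea_lift (uea_pi u) = free_lift f u.
Proof.
apply/eqP; rewrite -subr_eq0 -rmorphB; apply/eqP.
apply: (@uea_ideal_ker A (free_lift f)); last exact: uea_repr.
by apply: free_lift_rel => // a x y; exact: linearP.
Qed.

Fact uea_lift_zmod : zmod_morphism uea_lift.
Proof.
move=> x y; have [u ->] := uea_surj x; have [v ->] := uea_surj y.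
by rewrite -rmorphB !uea_lift_pi rmorphB.
Qed.

Fact uea_lift_monoid : monoid_morphism uea_lift.
Proof.
split=> [|x y]; first by rewrite -(rmorph1 uea_pi) uea_lift_pi rmorph1.
have [u ->] := uea_surj x; have [v ->] := uea_surj y.
by rewrite -rmorphM !uea_lift_pi rmorphM.
Qed.

Fact uea_lift_scalable : scalable uea_lift.
Proof.
move=> a x; have [u ->] := uea_surj x.
by rewrite -linearZ !uea_lift_pi linearZ.
Qed.

Theorem uea_universal : exists g : {lrmorphism uea -> A},
  (forall x, g (uea_in x) = f x) /\
  forall g' : {lrmorphism uea -> A}, (forall x, g' (uea_in x) = f x) -> g' =1 g.
Proof.
pose Z := GRing.isZmodMorphism.Build uea A uea_lift uea_lift_zmod.
pose M := GRing.isMonoidMorphism.Build uea A uea_lift uea_lift_monoid.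
pose S := GRing.isScalable.Build k uea A *:%R uea_lift uea_lift_scalable.
pose g : {lrmorphism uea -> A} := HB.pack uea_lift Z M S.
have gf x : g (uea_in x) = f x by rewrite /= uea_lift_pi free_lift_gen.
exists g; split=> // g' g'f x; have [u ->] := uea_surj x.
elim/free_ind: u => [|a s u IH]; first by rewrite !raddf0.
have -> : uea_pi (a *: \prod_(y <- s) gen y + u)
    = a *: \prod_(y <- s) uea_in y + uea_pi u.
  by rewrite linearP rmorph_prod.
rewrite [LHS]linearP [RHS]linearP; congr (_ *: _ + _); last exact: IH.
rewrite [LHS]rmorph_prod [RHS]rmorph_prod.
by apply: eq_bigr => y _; rewrite [LHS]g'f [RHS]gf.
Qed.

End Universal.
End UEA.

(* Main.v *)
From HB Require Import structures.
From mathcomp Require Import all_boot all_order all_algebra.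
From mathcomp Require Import boolp functions finmap monalg.
From mathcomp Require Import ring zify.
Require Import Defs.

(** Let [W] act on the pairs [(h, s)], with [h] a function from the integers to
    [k] and [s] a scalar, by

      e_n (h, s) = (m |-> - m h(m + n), n h(n)).

    The pairs [(0, s)] form a trivial submodule. Consider the elements [u] of
    the enveloping algebra that send every pair into this submodule. Their
    augmentation is 0, because the value of [h] at 0 is killed by every [e_n];
    so such a [u] acts by [(h, s) |-> (0, phi_u(h))] for some linear form
    [phi_u]. Among them, those with [phi_u(h) = 0] for every [h] that vanishes
    on the integers [<= N] form a left ideal, since [phi_(b u)] is [phi_u] times
    the scalar through which [b] acts on the submodule. These ideals increase
    with [N], and they never stabilise: the quadratic element
    [e_1 e_(N-1) - e_2 e_(N-2) - e_N] has [phi(h) = (3 - N) h(N)], which is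
    nonzero in characteristic 0 for [N >= 4]; this is
    [witt_mod_ideal_strict].

    Only the action of [W] and the elements [e_n] with [n >= 1] enter, so the
    argument is run for any Lie algebra with a Lie homomorphism to [W] whose
    image contains these [e_n]. This covers [W] and its positive part together
    and avoids a passage from one to the other through the
    Poincare-Birkhoff-Witt theorem.

    The antipode [x |-> - x] of the enveloping algebra is an anti-automorphism,
    hence a right noetherian enveloping algebra is left noetherian
    ([right_noetherian_uea_left]), which settles the other side. Finally both
    Lie algebras are infinite dimensional, so both equivalences hold between
    false statements. *)

Set Implicit Arguments.
Unset Strict Implicit.
Unset Printing Implicit Defensive.

Import Order.TTheory GRing.Theory Num.Theory.
Local Open Scope ring_scope.

(** * The opposite algebra *)

(** A fresh alias rather than the converse ring [A^c]: once [A^c] carries a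
    module structure, unification unfolds it and finds the multiplication of
    [A] on it. *)
Definition opposite (A : Type) : Type := A.

Section Opposite.
Variables (k : fieldType) (A : algType k).
Local Notation B := (opposite A).

HB.instance Definition _ := GRing.Zmodule.on B.

Definition opp_mul (x y : B) : B := (y : A) * (x : A).
Definition opp_scale (a : k) (x : B) : B := a *: (x : A).

Fact opp_mulA : associative opp_mul.
Proof. by move=> x y z; rewrite /opp_mul mulrA. Qed.
Fact opp_mul1x : left_id (1 : A) opp_mul.
Proof. by move=> x; rewrite /opp_mul mulr1. Qed.
Fact opp_mulx1 : right_id (1 : A) opp_mul.
Proof. by move=> x; rewrite /opp_mul mul1r. Qed.
Fact opp_mulDl : left_distributive opp_mul +%R.
Proof. move=> x y z; exact: (@mulrDr A). Qed.
Fact opp_mulDr : right_distributive opp_mul +%R.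
Proof. move=> x y z; exact: (@mulrDl A). Qed.
Fact opp_one_neq0 : (1 : A) != 0 :> B. Proof. exact: (@oner_neq0 A). Qed.

HB.instance Definition _ := GRing.Zmodule_isNzRing.Build B
  opp_mulA opp_mul1x opp_mulx1 opp_mulDl opp_mulDr opp_one_neq0.

Fact opp_scaleA (a b : k) (x : B) :
  opp_scale a (opp_scale b x) = opp_scale (a * b) x.
Proof. exact: (@scalerA k A). Qed.
Fact opp_scale1 : left_id 1 opp_scale.
Proof. exact: (@scale1r k A). Qed.
Fact opp_scaleDr : right_distributive opp_scale +%R.
Proof. exact: (@scalerDr k A). Qed.
Fact opp_scaleDl x : {morph opp_scale^~ x : a b / a + b}.
Proof. by move=> a b; apply: (@scalerDl k A). Qed.

HB.instance Definition _ := GRing.Zmodule_isLmodule.Build k B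
  opp_scaleA opp_scale1 opp_scaleDr opp_scaleDl.

Fact opp_scaleAl (a : k) (x y : B) : a *: (x * y) = (a *: x) * y.
Proof. exact: (@scalerAr k A). Qed.
HB.instance Definition _ := GRing.Lmodule_isLalgebra.Build k B opp_scaleAl.

Fact opp_scaleAr (a : k) (x y : B) : a *: (x * y) = x * (a *: y).
Proof. exact: (@scalerAl k A). Qed.
HB.instance Definition _ := GRing.Lalgebra_isAlgebra.Build k B opp_scaleAr.

End Opposite.

(** * The algebra of endomorphisms of a vector space *)

Section Endomorphisms.
Variables (k : fieldType) (V : lmodType k) (v : V).

(** The parameter [v != 0] is what makes the endomorphism ring nontrivial. *)
Record endo (v_neq0 : v != 0) := Endo { endo_fun :> {linear V -> V} }.

Variable v_neq0 : v != 0.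
Local Notation E := (endo v_neq0).
Implicit Types f g h : E.

Lemma endoP f g : f =1 g -> f = g.
Proof.
case: f g => f [g] /= fg; congr Endo.
case: f g fg => f fP [g gP] /= /funext fg; subst g; congr GRing.Linear.Pack.
case: fP gP => [[f0] [fZ]] [[g0] [gZ]].
by rewrite (Prop_irrelevance f0 g0) (Prop_irrelevance fZ gZ).
Qed.

HB.instance Definition _ := gen_eqMixin E.
HB.instance Definition _ := gen_choiceMixin E.

Definition endo_zero : E := Endo _ \0.
Definition endo_one : E := Endo _ idfun.
Definition endo_opp f : E := Endo _ (\- f).
Definition endo_add f g : E := Endo _ (f \+ g).
Definition endo_mul f g : E := Endo _ (f \o g).
Definition endo_scale (a : k) f : E := Endo _ (a \*: f).

Fact endo_addA : associative endo_add.
Proof. by move=> f g h; apply: endoP => x; apply: addrA. Qed.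
Fact endo_addC : commutative endo_add.
Proof. by move=> f g; apply: endoP => x; apply: addrC. Qed.
Fact endo_add0 : left_id endo_zero endo_add.
Proof. by move=> f; apply: endoP => x; apply: add0r. Qed.
Fact endo_addN : left_inverse endo_zero endo_opp endo_add.
Proof. by move=> f; apply: endoP => x; apply: addNr. Qed.

HB.instance Definition _ := GRing.isZmodule.Build E
  endo_addA endo_addC endo_add0 endo_addN.

Fact endo_mulA : associative endo_mul.
Proof. by move=> f g h; apply: endoP. Qed.
Fact endo_mul1x : left_id endo_one endo_mul.
Proof. by move=> f; apply: endoP. Qed.
Fact endo_mulx1 : right_id endo_one endo_mul.
Proof. by move=> f; apply: endoP. Qed.
Fact endo_mulDl : left_distributive endo_mul +%R.
Proof. by move=> f g h; apply: endoP. Qed.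
Fact endo_mulDr : right_distributive endo_mul +%R.
Proof. by move=> f g h; apply: endoP => x /=; rewrite raddfD. Qed.
Fact endo_one_neq0 : endo_one != 0.
Proof.
apply/eqP => /(congr1 (fun f : E => f v)) /= v0.
by move: v_neq0; rewrite -[v]/(endo_one v) v0 eqxx.
Qed.

HB.instance Definition _ := GRing.Zmodule_isNzRing.Build E
  endo_mulA endo_mul1x endo_mulx1 endo_mulDl endo_mulDr endo_one_neq0.

Fact endo_scaleA (a b : k) f :
  endo_scale a (endo_scale b f) = endo_scale (a * b) f.
Proof. by apply: endoP => x; apply: scalerA. Qed.
Fact endo_scale1 : left_id 1 endo_scale.
Proof. by move=> f; apply: endoP => x; apply: scale1r. Qed.
Fact endo_scaleDr : right_distributive endo_scale +%R.
Proof. by move=> a f g; apply: endoP => x; apply: scalerDr. Qed.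
Fact endo_scaleDl f : {morph endo_scale^~ f : a b / a + b}.
Proof. by move=> a b; apply: endoP => x; apply: scalerDl. Qed.

HB.instance Definition _ := GRing.Zmodule_isLmodule.Build k E
  endo_scaleA endo_scale1 endo_scaleDr endo_scaleDl.

Fact endo_scaleAl (a : k) f g : a *: (f * g) = (a *: f) * g.
Proof. exact: endoP. Qed.
HB.instance Definition _ := GRing.Lmodule_isLalgebra.Build k E endo_scaleAl.

Fact endo_scaleAr (a : k) f g : a *: (f * g) = f * (a *: g).
Proof. by apply: endoP => x; rewrite /= linearZ. Qed.
HB.instance Definition _ := GRing.Lalgebra_isAlgebra.Build k E endo_scaleAr.

Lemma endo0E x : (0 : E) x = 0. Proof. by []. Qed.
Lemma endoDE f g x : (f + g) x = f x + g x. Proof. by []. Qed.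
Lemma endoBE f g x : (f - g) x = f x - g x. Proof. by []. Qed.
Lemma endoME f g x : (f * g) x = f (g x). Proof. by []. Qed.
Lemma endoZE (a : k) f x : (a *: f) x = a *: f x. Proof. by []. Qed.

End Endomorphisms.

(** * The antipode of an enveloping algebra *)

Section Antipode.
Variables (k : fieldType) (L : lieAlgType k).
Local Notation U := (uea L).

Lemma uea_ind (P : U -> Prop) :
    P 1 -> (forall x, P (uea_in x)) ->
    (forall (a : k) u v, P u -> P v -> P (a *: u + v)) ->
    (forall u v, P u -> P v -> P (u * v)) ->
  forall u, P u.
Proof.
move=> P1 Pin PD PM x; have [u ->] := uea_surj x.
have P0 : P 0 by rewrite -(subrr 1) addrC -scaleN1r; apply: PD.
elim/free_ind: u => [|a s u IH]; first by rewrite raddf0.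
rewrite linearP rmorph_prod; apply: PD => //.
by apply: (big_ind P) => // y _; apply: Pin.
Qed.

(** Negation is a Lie homomorphism from [L] to the commutator bracket of the
    opposite algebra, so the universal property extends it to [U]. *)
Let anti (x : L) : opposite U := - uea_in x.

Fact anti_linear : linear anti.
Proof. by move=> a x y; rewrite /anti linearP opprD -scalerN. Qed.

HB.instance Definition _ := GRing.isLinear.Build k L (opposite U) *:%R anti
  anti_linear.

Lemma uea_antipode : exists S : U -> U,
  [/\ linear S, S 1 = 1, forall u v, S (u * v) = S v * S u & involutive S].
Proof.
have anti_lie x y : anti (lie x y) = anti x * anti y - anti y * anti x.
  rewrite /anti uea_in_lie opprB
    -[RHS]/(- uea_in y * - uea_in x - (- uea_in x * - uea_in y)).
  by rewrite !mulrNN.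
have [S [Sin _]] := uea_universal anti_lie.
(* [T] forgets that the codomain of [S] is the opposite algebra. *)
pose T : U -> U := S.
have Tlin : linear T by move=> a u v; have := linearP S a u v.
have T1 : T 1 = 1 by have := rmorph1 S.
have TM u v : T (u * v) = T v * T u by have := rmorphM S u v.
have TN u : T (- u) = - T u by have := raddfN S u.
have Tin x : T (uea_in x) = - uea_in x by have := Sin x.
exists T; split=> //; elim/uea_ind => [|x|a u v IHu IHv|u v IHu IHv].
- by rewrite !T1.
- by rewrite Tin TN Tin opprK.
- by rewrite !Tlin IHu IHv.
- by rewrite !TM IHu IHv.
Qed.

(** The antipode exchanges left and right ideals. *)
Lemma right_noetherian_uea_left : right_noetherian U -> left_noetherian U.
Proof.
have [S [Slin _ SM SS]] := uea_antipode.
have S0 : S 0 = 0.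
  by rewrite -[in LHS](subrr 0) addrC -scaleN1r Slin scaleN1r addNr.
have SD u v : S (u + v) = S u + S v by rewrite -[u]scale1r Slin !scale1r.
move=> ru I Il Iinc; have [|n u|N NP] := ru (fun n u => I n (S u)).
- move=> n; have [I0 ID IM] := Il n.
  split=> [|u v|a u]; first by rewrite S0.
    by rewrite SD; apply: ID.
  by rewrite SM; apply: IM.
- exact: Iinc.
by exists N => n Nn u; rewrite -[u]SS; apply: NP.
Qed.
End Antipode.

(** * A module over the Witt algebra *)

Section WittModule.
Variable k : fieldType.
Local Notation W := (witt k).

(** The linear extension to [W] of a function [h] on its basis. *)
Definition witt_pair (x : W) (h : int -> k) : k := mmap idfun h x.

Lemma witt_pair_eE n h : witt_pair (witt_e k n) h = h n.
Proof. by rewrite /witt_pair mmapU mul1r. Qed.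

Lemma witt_pairDZl (a : k) x y h :
  witt_pair (a *: x + y) h = a * witt_pair x h + witt_pair y h.
Proof.
rewrite /witt_pair mmapD; congr (_ + _).
rewrite (mmapEw (msuppZ_le _ _)) mulr_sumr.
by apply: eq_bigr => n _; rewrite mcoeffZ mulrA.
Qed.

Lemma witt_pairDZr (a : k) x g h :
  witt_pair x (fun n => a * g n + h n) = a * witt_pair x g + witt_pair x h.
Proof.
rewrite /witt_pair !mmapE mulr_sumr -big_split; apply: eq_bigr => n _ /=.
by rewrite mulrDr mulrCA.
Qed.

(** The dual of an extension of the trivial module [k v0] by [k[t, t^-1]], on
    which [e_n] acts as [t^(n+1) d/dt]: a pair [(h, s)] is the linear form with
    values [h m] at [t^m] and [s] at [v0]. The extension is given by the cocycle
    [e_n v0 = - n t^n], the divergence of [- e_n] with respect to [dt/t]. *)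
Definition witt_mod : Type := ((int -> k^o) * k^o)%type.
HB.instance Definition _ := GRing.Lmodule.on witt_mod.

Lemma witt_mod1P (a : k) (v w : witt_mod) :
  (a *: v + w).1 = a *: v.1 + w.1.
Proof. by []. Qed.
Lemma witt_mod1D (v w : witt_mod) : (v + w).1 = v.1 + w.1.
Proof. by []. Qed.
Lemma witt_mod2D (v w : witt_mod) : (v + w).2 = v.2 + w.2.
Proof. by []. Qed.

Definition witt_mod_fun (x : W) (v : witt_mod) : witt_mod :=
  (fun m => - (m%:~R * witt_pair x (fun n => v.1 (m + n))),
   witt_pair x (fun n => n%:~R * v.1 n)).

Fact witt_mod_fun_linear x : linear (witt_mod_fun x).
Proof.
move=> a u v; congr pair; [apply/funext => m|].
  rewrite -[X in _ * X]/(witt_pair x (fun n => a * u.1 (m + n) + v.1 (m + n))).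
  have E (c p q : k) : - (c * (a * p + q)) = a * - (c * p) + - (c * q) by ring.
  by rewrite witt_pairDZr; exact: E.
rewrite -[RHS]/(a * witt_pair x (fun n => n%:~R * u.1 n)
  + witt_pair x (fun n => n%:~R * v.1 n)).
rewrite -witt_pairDZr; congr witt_pair; apply/funext => n.
have E (c p q : k) : c * (a * p + q) = a * (c * p) + c * q by ring.
exact: E.
Qed.

HB.instance Definition _ x :=
  GRing.isLinear.Build k witt_mod witt_mod *:%R (witt_mod_fun x)
    (witt_mod_fun_linear x).

Fact witt_mod_neq0 : ((0, 1) : witt_mod) != 0.
Proof. by apply/eqP => -[/eqP]; rewrite oner_eq0. Qed.

Definition witt_mod_act (x : W) : endo witt_mod_neq0 := Endo _ (witt_mod_fun x).

Fact witt_mod_act_linear : linear witt_mod_act.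
Proof.
move=> a x y; apply: endoP => v; congr pair; [apply/funext => m|].
  have E (c p q : k) : - (c * (a * p + q)) = a * - (c * p) + - (c * q) by ring.
  by rewrite /= witt_pairDZl; exact: E.
by rewrite /= witt_pairDZl.
Qed.

HB.instance Definition _ :=
  GRing.isLinear.Build k W (endo witt_mod_neq0) *:%R witt_mod_act
    witt_mod_act_linear.

Lemma witt_mod_act_e n v :
  witt_mod_act (witt_e k n) v
    = (fun m => - (m%:~R * v.1 (m + n)), n%:~R * v.1 n).
Proof.
rewrite /= /witt_mod_fun witt_pair_eE; congr pair; apply/funext => m.
by rewrite witt_pair_eE.
Qed.

Lemma witt_mod_act_lie x y :
  witt_mod_act (lie x y)
    = witt_mod_act x * witt_mod_act y - witt_mod_act y * witt_mod_act x.
Proof.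
elim/witt_ind: x => [|a n x IHx].
  by rewrite [lie 0 y]witt_lie0l !raddf0 mul0r mulr0 subr0.
rewrite lieDZl !witt_mod_act_linear IHx mulrDl mulrDr.
suff -> : witt_mod_act (lie (witt_e k n) y)
    = witt_mod_act (witt_e k n) * witt_mod_act y
    - witt_mod_act y * witt_mod_act (witt_e k n).
  by rewrite scalerBr -scalerAl -scalerAr opprD addrACA.
elim/witt_ind: y {IHx} => [|b p y IHy].
  by rewrite [lie _ 0]witt_lie0r !raddf0 mul0r mulr0 subr0.
rewrite lieDZr !witt_mod_act_linear IHy mulrDl mulrDr -scalerAl -scalerAr.
suff -> : witt_mod_act (lie (witt_e k n) (witt_e k p)) =
    witt_mod_act (witt_e k n) * witt_mod_act (witt_e k p)
    - witt_mod_act (witt_e k p) * witt_mod_act (witt_e k n).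
  by rewrite scalerBr opprD addrACA.
rewrite lie_witt_e linearZ; apply: endoP => v.
rewrite endoZE endoBE !endoME !witt_mod_act_e /=.
congr pair; [apply/funext => m|].
  have E (q q1 q2 : k) : q1 = q -> q2 = q ->
      (p - n)%:~R * - (m%:~R * q) = - (m%:~R * - ((m + n)%:~R * q1))
        - - (m%:~R * - ((m + p)%:~R * q2)).
    by move=> -> ->; rewrite intrB !intrD; ring.
  by apply: E; rewrite addrA // addrAC.
have E (c d q : k) :
  (d - c) * ((c + d) * q) = c * - (c * q) - d * - (d * q) by ring.
rewrite /= [p + n]addrC intrB intrD; exact: E.
Qed.
End WittModule.

(** * Ideals that do not stabilise *)

Section NonNoetherian.
(* Stated for [L] over [W] so as to cover [W] and its positive part at once. *)
Variables (k : fieldType) (L : lieAlgType k) (f : {linear L -> witt k}).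
Hypothesis char0 : [pchar k] =i pred0.
Hypothesis f_lie : forall x y, f (lie x y) = lie (f x) (f y).
Hypothesis f_pos : forall n : int, 1 <= n -> exists x, f x = witt_e k n.

Lemma uea_witt_mod : exists g : {lrmorphism uea L -> endo (witt_mod_neq0 k)},
  forall x, g (uea_in x) = witt_mod_act (f x).
Proof.
have [x y|g [gE _]] := @uea_universal k L _ (@witt_mod_act k \o f).
  by rewrite /= f_lie witt_mod_act_lie.
by exists g.
Qed.

Section Ideals.
Variable g : {lrmorphism uea L -> endo (witt_mod_neq0 k)}.
Hypothesis gE : forall x, g (uea_in x) = witt_mod_act (f x).

(** The first condition makes [u] act through a linear form on the functions
    [h], the second makes this form depend only on the values of [h] at the
    integers [m <= N]. *)
Definition witt_mod_ideal (N : int) (u : uea L) := forall v : witt_mod k,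
  (g u v).1 = 0 /\ ((forall m, m <= N -> v.1 m = 0) -> (g u v).2 = 0).

Lemma uea_actB u w v : g (u - w) v = g u v - g w v.
Proof. by rewrite (raddfB g). Qed.
Lemma uea_actM u w v : g (u * w) v = g u (g w v).
Proof. by rewrite (rmorphM g). Qed.

Lemma uea_act_in2 x y v :
  g (uea_in x * uea_in y) v = witt_mod_act (f x) (witt_mod_act (f y) v).
Proof. by rewrite uea_actM gE gE. Qed.

(** Stated with variables: rewriting with the morphism laws of [g] below a
    concrete product makes unification unfold the quotient [uea L]. *)
Lemma uea_act_quadratic x1 y1 x2 y2 y v :
  g (uea_in x1 * uea_in y1 - uea_in x2 * uea_in y2 - uea_in y) v
    = witt_mod_act (f x1) (witt_mod_act (f y1) v)
      - witt_mod_act (f x2) (witt_mod_act (f y2) v) - witt_mod_act (f y) v.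
Proof.
rewrite uea_actB uea_actB; congr (_ - _ - _); last by rewrite gE.
  exact: uea_act_in2.
exact: uea_act_in2.
Qed.

Lemma uea_act_stable u v : v.1 = 0 -> (g u v).1 = 0.
Proof.
move=> v0; elim/uea_ind: u v v0 => [|x|a u w IHu IHw|u w IHu IHw] v v0.
- by rewrite rmorph1.
- rewrite gE /= v0; apply/funext => m.
  suff -> : witt_pair (f x) (fun=> 0) = 0 by rewrite mulr0 oppr0.
  by rewrite /witt_pair mmapE big1 // => n _; rewrite mulr0.
- by rewrite (linearP g) endoDE endoZE witt_mod1P IHu // IHw // scaler0 addr0.
- by rewrite rmorphM endoME IHu // IHw.
Qed.

Lemma witt_mod_ideal_left N : left_ideal (witt_mod_ideal N).
Proof.
split=> [v|u w Iu Iw v|b u Iu v].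
- by rewrite raddf0 endo0E.
- have [u1 u2] := Iu v; have [w1 w2] := Iw v.
  rewrite raddfD; split=> [|vN].
    by rewrite endoDE witt_mod1D u1 w1 addr0.
  by rewrite endoDE witt_mod2D u2 // w2 // addr0.
have [u1 u2] := Iu v.
rewrite rmorphM endoME; split=> [|vN]; first exact: uea_act_stable.
by rewrite [g u v]surjective_pairing u1 u2 // -[(0, 0)]/(0 : witt_mod k) raddf0.
Qed.

Lemma witt_mod_ideal_le (M N : int) u :
  M <= N -> witt_mod_ideal M u -> witt_mod_ideal N u.
Proof.
move=> MN Iu v; have [u1 u2] := Iu v; split=> // vN.
by apply: u2 => m mM; apply/vN/(le_trans mM).
Qed.

(** With [N = n + 4], the element [e_1 e_(N-1) - e_2 e_(N-2) - e_N] acts by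
    [(h, s) |-> (0, (3 - N) h(N))]: on [h] the three terms contribute
    [m (m + 1)], [- m (m + 2)] and [m] times [h(m + N)], which cancel; on the
    second coordinate they contribute [- 1], [4] and [- N] times [h(N)]. *)
Lemma witt_mod_ideal_strict (n : nat) :
  exists u, witt_mod_ideal (n + 4)%:Z u /\ ~ witt_mod_ideal (n + 3)%:Z u.
Proof.
have [//|x1 fx1] := @f_pos 1; have [//|x2 fx2] := @f_pos 2.
have [//|y1 fy1] := @f_pos (n + 3)%:Z; first lia.
have [//|y2 fy2] := @f_pos (n + 2)%:Z; first lia.
have [//|y fy] := @f_pos (n + 4)%:Z; first lia.
pose u := uea_in x1 * uea_in y1 - uea_in x2 * uea_in y2 - uea_in y.
have uE v : g u v = (0, - n.+1%:R * v.1 (n + 4)%:Z).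
  rewrite /u uea_act_quadratic fx1 fx2 fy1 fy2 fy.
  rewrite !witt_mod_act_e /=; congr pair; [apply/funext => m|].
    have E (q q1 q2 : k) : q1 = q -> q2 = q ->
        - (m%:~R * - ((m + 1)%:~R * q1)) - - (m%:~R * - ((m + 2)%:~R * q2))
          - - (m%:~R * q) = 0.
      by move=> -> ->; rewrite !intrD; ring.
    by apply: E; congr (v.1 _); lia.
  rewrite /=.
  have E (q q1 q2 : k) : q1 = q -> q2 = q ->
      1%:~R * - (1%:~R * q1) - 2%:~R * - (2%:~R * q2) - (n + 4)%:Z%:~R * q
        = - n.+1%:R * q.
    by move=> -> ->; rewrite -[n.+1]addn1 -[_%:Z%:~R]/((n + 4)%:R) !natrD; ring.
  by apply: E; congr (v.1 _); lia.
(* The vector [(h, 0)] with [h] the indicator of [N] tells the two ideals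
   apart. *)
exists u; split=> [v|/(_ ((fun m => (m == (n + 4)%:Z)%:R), 0))].
  by rewrite uE; split=> // vN; rewrite /= vN ?mulr0.
rewrite uE /= eqxx mulr1 => -[_ /(_ _)/eqP]; rewrite oppr_eq0 => n0.
have /n0 : forall m : int, m <= (n + 3)%:Z -> (m == (n + 4)%:Z)%:R = 0 :> k.
  by move=> m mn; case: eqP => // mE; move: mn; rewrite mE; lia.
by have /pcharf0P -> := char0.
Qed.

Lemma not_left_noetherian_of_uea_action : ~ left_noetherian (uea L).
Proof.
move=> /(_ (fun n => witt_mod_ideal (n + 3)%:Z)); case=> [n|n u|n nP].
- exact: witt_mod_ideal_left.
- by apply: witt_mod_ideal_le; lia.
have [u [un]] := witt_mod_ideal_strict n; apply.
by apply/(nP n.+1 (leqnSn n)); rewrite addSnnS.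
Qed.

End Ideals.

Lemma not_left_noetherian_uea : ~ left_noetherian (uea L).
Proof. by have [g /not_left_noetherian_of_uea_action] := uea_witt_mod. Qed.

Lemma not_right_noetherian_uea : ~ right_noetherian (uea L).
Proof. by move/right_noetherian_uea_left; apply: not_left_noetherian_uea. Qed.

End NonNoetherian.

(** Finitely many vectors of [L] have images with finitely many nonzero
    coordinates altogether, so that [e_n] is not in their span for large [n]. *)
Lemma witt_cover_not_finite_dim (k : fieldType) (L : lmodType k)
    (f : {linear L -> witt k}) :
  (forall n : int, 1 <= n -> exists x, f x = witt_e k n) -> ~ finite_dim L.
Proof.
move=> f_pos [d [b bP]].
pose n : nat := (\sum_(i < d) \sum_(m <- msupp (f (b i))) `|m|%N).+1.
have bn i : (f (b i))@_(n%:Z) = 0.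
  apply/eqP; rewrite mcoeff_eq0; apply/negP => n_supp.
  have : (n <= \sum_(i < d) \sum_(m <- msupp (f (b i))) `|m|%N)%N.
    by rewrite (bigD1 i) //= (big_fsetD1 _ n_supp) /= -addnA leq_addr.
  by rewrite /n ltnn.
have [//|x fx] := f_pos n%:Z.
have [c xE] := bP x; have /eqP := oner_eq0 k; case.
suff : (f x)@_(n%:Z) = 0 by rewrite fx mcoeffUU.
rewrite xE linear_sum raddf_sum big1 // => i _.
by rewrite /= (linearZ_LR f) mcoeffZ bn mulr0.
Qed.

(** * The Witt algebra and its positive part *)

Theorem theorem0p5 (k : fieldType) (char0 : [pchar k] =i pred0) :
  [/\ ~ right_noetherian (uea (witt_pos k)) /\ ~ left_noetherian (uea (witt_pos k)),
      ~ right_noetherian (uea (witt k)) /\ ~ left_noetherian (uea (witt k)),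
      finite_dim (witt k) <-> noetherian (uea (witt k))
    & finite_dim (witt_pos k) <-> noetherian (uea (witt_pos k))].
Proof.
pose f : {linear witt k -> witt k} := idfun.
have f_lie x y : f (lie x y) = lie (f x) (f y) by [].
have f_pos (n : int) : 1 <= n -> exists x, f x = witt_e k n.
  by exists (witt_e k n).
pose g : {linear witt_pos k -> witt k} := val.
have g_lie x y : g (lie x y) = lie (g x) (g y) by [].
have g_pos (n : int) : 1 <= n -> exists x, g x = witt_e k n.
  move=> n1; have en : witt_e k n \in lie_gen (@witt_pos_gen k).
    by apply: mem_lie_gen; exists n.
  by exists (LieGenOf en).
have Wl := not_left_noetherian_uea char0 f_lie f_pos.
have Wr := not_right_noetherian_uea char0 f_lie f_pos.
have Pl := not_left_noetherian_uea char0 g_lie g_pos.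
have Pr := not_right_noetherian_uea char0 g_lie g_pos.
split.
- exact: conj Pr Pl.
- exact: conj Wr Wl.
- by split=> [/(witt_cover_not_finite_dim f_pos)|[_ /Wr []]].
- by split=> [/(witt_cover_not_finite_dim g_pos)|[_ /Pr []]].
Qed.
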